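(* Given any $c_0\in\mathbb R\setminus\{-1\}$ there exist $a,b\in[0,1)\cong\mathbb S$ with $a<b$ and a function $u_0\in C^\infty(\mathbb S)$, not identically equal to $c_0$, such that the corresponding solution $u=u(x,t)$ of the periodic problem $$\partial_t u+(1-\partial_x^2)^{-1}(\partial_x u+u\,\partial_x u)=0,\qquad u(x,0)=u_0(x),\quad x\in\mathbb S,$$ satisfies $$u_0(x)=c_0,\qquad x\in(a,b)\subset[0,1)\cong\mathbb S,$$ and $$\partial_tu(a,0)=\partial_tu(b,0).$$
   Context: $\mathbb S=\mathbb R/\mathbb Z\cong[0,1)$, and $H^s(\mathbb S)$ is the usual $L^2$-based Sobolev space of real-valued functions. The nonlocal term is understood as $\partial_x(1-\partial_x^2)^{-1}\big(u+\tfrac{u^2}{2}\big)$, where $\partial_x(1-\partial_x^2)^{-1}h=\partial_x\mathcal G*h$ (convolution on $\mathbb S$) with $$\mathcal G(x)=\frac{\cosh(x-\lfloor x\rfloor-1/2)}{2\sinh(1/2)},\qquad \partial_x\mathcal G(x)=\frac{\sinh(x-\lfloor x\rfloor-1/2)}{2\sinh(1/2)} .$$ A solution satisfies $u(t)=u_0-\int_0^t\partial_x(1-\partial_x^2)^{-1}(u+\tfrac{u^2}{2})(t')\,dt'$. It is known (Rosier-Zhang) that for every $s\ge0$, $u_0\in H^s(\mathbb S)$ and $T>0$ there is a unique solution $u\in C([-T,T]:H^s(\mathbb S))$; ''the corresponding solution'' is this one. *)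

(* Defs.v *)
From HB Require Import structures.
From mathcomp Require Import all_boot all_order all_algebra.
From mathcomp Require Import all_classical all_reals all_analysis.

Set Implicit Arguments.
Unset Strict Implicit.
Unset Printing Implicit Defensive.

Import Order.TTheory GRing.Theory Num.Theory.
Import numFieldNormedType.Exports.

Local Open Scope classical_set_scope.
Local Open Scope ring_scope.

(* Functions on the circle R/Z are functions R -> R with [periodic f 1];
   integrals over the circle are Lebesgue integrals over [0, 1]. *)

Definition sinh {R : realType} (x : R) : R := (expR x - expR (- x)) / 2.

(* The derivative of the Green function
     G x = cosh (x - floor x - 1/2) / (2 sinh (1/2))
   of 1 - d^2/dx^2 on R/Z; at the integers, where G is not differentiable,
   the value is a convention that does not affect convolutions. *)
Definition dxG {R : realType} (x : R) : R :=
  sinh (x - (Num.floor x)%:~R - 1 / 2) / (2 * sinh (1 / 2)).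

Definition circle_conv {R : realType} (g h : R -> R) (x : R) : R :=
  (\int[lebesgue_measure]_(y in `[0, 1]) (g (x - y) * h y))%R.

Definition bbm_nonlocal {R : realType} (v : R -> R) : R -> R :=
  circle_conv dxG (fun y => v y + v y ^+ 2 / 2).

Definition smooth {R : realType} (f : R -> R) : Prop :=
  forall (n : nat) (x : R), derivable (derive1n n f) x 1.

Definition L2_sqnorm {R : realType} (f : R -> R) : \bar R :=
  (\int[lebesgue_measure]_(x in `[0%R, 1%R]) (f x ^+ 2)%:E)%E.

(* The squared modulus of the Fourier coefficient of a real-valued f,
   \int_0^1 f(x) exp(-2 i pi k x) dx, written through its real and imaginary
   parts. *)
Definition fourier_sqmod {R : realType} (f : R -> R) (k : int) : R :=
  (\int[lebesgue_measure]_(x in `[0, 1])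
      (f x * cos (2 * pi * k%:~R * x)))%R ^+ 2 +
  (\int[lebesgue_measure]_(x in `[0, 1])
      (f x * sin (2 * pi * k%:~R * x)))%R ^+ 2.

(* For s >= 0, |f|_{H^s}^2 = |f|_{L^2}^2 + | |d/dx|^s f |_{L^2}^2, which is
   equivalent to \sum_k (1 + k^2)^s |f^(k)|^2. *)
Definition sobolev_sqnorm {R : realType} (s : R) (f : R -> R) : \bar R :=
  (L2_sqnorm f +
   \esum_(k in [set: int])
     ((`|2 * pi * k%:~R| `^ (2 * s) * fourier_sqmod f k)%R)%:E)%E.

Definition sobolev {R : realType} (s : R) (f : R -> R) : Prop :=
  [/\ periodic f 1, measurable_fun [set: R] f & (sobolev_sqnorm s f < +oo)%E].

Definition oriented_integral0 {R : realType} (t : R) (g : R -> R) : R :=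
  if 0 <= t then (\int[lebesgue_measure]_(r in `[0, t]) g r)%R
  else - (\int[lebesgue_measure]_(r in `[t, 0]) g r)%R.

Definition C_sobolev {R : realType} (s T : R) (u : R -> R -> R) : Prop :=
  forall t, t \in `[- T, T] ->
    sobolev s (u t) /\
    (fun r => sobolev_sqnorm s (u r \- u t))
      @ within `[- T, T]%classic (nbhs t) --> (0 : \bar R)%E.

(* u t x is the solution at time t and position x.  The integral equation is
   imposed at every x, not just almost every x: its integral term is continuous
   in x, so for continuous u0 this picks the continuous representative of each
   class u t, and u t x is meaningful pointwise even for s = 0. *)
Definition bbm_solution {R : realType} (s T : R) (u0 : R -> R)
    (u : R -> R -> R) : Prop :=
  C_sobolev s T u /\
  forall t, t \in `[- T, T] -> forall x,
    u t x = u0 x - oriented_integral0 t (fun r => bbm_nonlocal (u r) x).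

(* Main.v *)
Require Import Defs.
From HB Require Import structures.
From mathcomp Require Import all_boot all_order all_algebra.
From mathcomp Require Import all_classical all_reals all_analysis measurable_realfun.
From mathcomp Require Import ring lra.
Import Order.TTheory GRing.Theory Num.Theory.
Import numFieldNormedType.Exports.
Local Open Scope classical_set_scope.
Local Open Scope ring_scope.

(* If u0 = c0 + t chi then w := u0 + u0^2/2 equals, up to an additive constant,
   t (1 + c0) chi + (t^2/2) chi^2. Let chi >= 0 be a smooth bump vanishing on
   [0, 1/2]. Since the kernel dxG kills constants,
     d_t u(1/2, 0) - d_t u(0, 0)
       = - \int_0^1 (dxG (1/2 - y) - dxG (0 - y)) w(y) dy
       = - (t (1 + c0) A + (t^2/2) B),
   where A, B > 0 because the difference of kernels is positive on (1/2, 1).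
   So t = - 2 (1 + c0) A / B, which is nonzero as c0 <> -1, balances the two
   endpoints a = 0 and b = 1/2.  That d_t u(x, 0) = - bbm_nonlocal u0 x holds in
   the classical sense at every x follows from the continuity of
   r |-> bbm_nonlocal (u r) x, a consequence of L^2-continuity of u. *)

(** * Smooth functions and the periodic bump *)

(** By induction on the order, every iterated derivative of [f] stays in the class [P], hence is
    itself derivable. *)
Lemma smooth_of_closed {R : realType} (P : (R -> R) -> Prop) :
  (forall f, P f -> exists2 g, P g & forall x, is_derive x (1 : R) f (g x)) ->
  forall f, P f -> smooth f.
Proof.
move=> dP f Pf n; suff /dP[g _ dg] : P (derive1n n f) by move=> x.
elim: n => [//|n /dP[g Pg dg]]; rewrite derive1nS.
suff -> : (derive1n n f)^`()%classic = g by [].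
by apply/funext => x; rewrite derive1E derive_val.
Qed.

(** The classical function exp(-1/x) extended by 0, with a factor x^(-m) so that the family contains
    the building blocks of all its derivatives. *)
Definition flat {R : realType} (m : nat) (x : R) : R :=
  if 0 < x then x ^- m * expR (- x^-1) else 0.

Lemma flat_ge0 {R : realType} (m : nat) (x : R) : 0 <= flat m x.
Proof.
rewrite /flat; case: ifPn => // x0.
by rewrite mulr_ge0 ?expR_ge0// invr_ge0 exprn_ge0// ltW.
Qed.

Lemma flat_gt0 {R : realType} (m : nat) (x : R) : 0 < x -> 0 < flat m x.
Proof. by move=> x0; rewrite /flat x0 mulr_gt0 ?expR_gt0// invr_gt0 exprn_gt0. Qed.

(** The term of order m + 2 in the exponential series bounds exp(1/x) from below. Quadratic decay is
    what differentiability at 0 requires. *)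
Lemma flat_le {R : realType} (m : nat) (x : R) :
  flat m x <= (m.+2)`!%:R * x ^+ 2.
Proof.
rewrite /flat; case: ifPn => [x0|_]; last by rewrite mulr_ge0// sqr_ge0.
rewrite expRN mulrC ler_pdivrMl ?exprn_gt0 ?expR_gt0//.
rewrite -ler_pdivrMr ?mulr_gt0 ?exprn_gt0 ?ltr0n ?fact_gt0//.
have xV0 : 0 <= x^-1 by rewrite invr_ge0 ltW.
apply: le_trans (expR_ge1Dxn m.+1 xV0).
rewrite -[leLHS]add0r lerD// exprVn invfM -!exprVn mulrCA mulrC.
by rewrite -exprD addn2.
Qed.

(** For x > 0 this is the product rule; at 0 the difference quotient is at most (m + 2)! |h| by
    [flat_le], so it tends to 0. *)
Lemma is_derive_flat {R : realType} (m : nat) (x : R) :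
  is_derive x (1 : R) (flat m) (flat m.+2 x - m%:R * flat m.+1 x).
Proof.
have [x0|x0|->] := ltgtP x 0.
- have -> : flat m.+2 x - m%:R * flat m.+1 x = 0.
    by rewrite /flat ltNge (ltW x0)/= mulr0 subr0.
  apply: (@near_eq_is_derive _ _ _ (cst (0 : R))).
  by near=> y; rewrite /flat/= ltNge ifF//; apply/negbF/ltW; near: y; exact: lt_nbhsl.
- have x00 : x != 0 by rewrite gt_eqF.
  have dV : is_derive x (1 : R) (fun y : R => y^-1) (- x ^- 2).
    have := is_deriveV x00 (is_derive_id x (1 : R)).
    by rewrite /GRing.scale/= mulr1.
  have dE : is_derive x (1 : R) (fun y : R => expR (- y^-1))
      (expR (- x^-1) * x ^- 2).
    apply: (@is_derive1_comp _ expR (fun y : R => - y^-1)).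
    by apply: is_derive_eq; rewrite opprK.
  have dP : is_derive x (1 : R) (fun y : R => (y^-1) ^+ m)
      (- (m%:R * x^-1 ^+ m.+1)).
    have -> : (fun y : R => y^-1 ^+ m) = (fun y : R => y^-1) ^+ m.
      by apply/funext => y; rewrite exprfctE.
    apply: is_derive_eq; rewrite /GRing.scale/= -exprVn.
    case: (m) => [|k]; first by rewrite !mul0r oppr0.
    by rewrite mulrN -mulrA -exprD addn2.
  apply: (@near_eq_is_derive _ _ _ (fun y : R => (y^-1) ^+ m * expR (- y^-1))).
    by near=> y; rewrite /flat/= ifT ?exprVn//; near: y; exact: lt_nbhsr.
  apply: (@is_derive_eq _ _ _ _ _ _ _ _ (is_deriveM dP dE)).
  by rewrite /flat x0 /GRing.scale/= -!exprVn !exprS; ring.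
- have -> : flat m.+2 0 - m%:R * flat m.+1 0 = 0 :> R.
    by rewrite /flat ltxx mulr0 subr0.
  have cv : h^-1 *: (flat m (h *: 1 + 0) - flat m 0) @[h --> (0 : R)^'] --> (0 : R).
    apply/norm_cvg0P; apply: (@squeeze_cvgr _ _ _ _ (cst 0)
      (fun h : R => (m.+2)`!%:R * `|h|)).
    + near=> h; rewrite normr_ge0/= {2}/flat ltxx subr0 addr0 /GRing.scale/= mulr1.
      have h0 : h != 0 by near: h; exact: nbhs_dnbhs_neq.
      rewrite normrM normfV ler_pdivrMl ?normr_gt0// ger0_norm ?flat_ge0//.
      by rewrite mulrCA -expr2 real_normK ?num_real// flat_le.
    + exact: cvg_cst.
    + rewrite -[X in _ --> X](mulr0 (m.+2)`!%:R); apply: cvgMr.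
      rewrite -[X in _ --> X](normr0 R); apply: cvg_norm.
      exact: cvg_within.
  apply: DeriveDef; first by apply/cvg_ex; exists 0.
  exact/cvg_lim.
Unshelve. all: by end_near. Qed.

(* This class of functions is closed under differentiation, which yields the
   smoothness of [bump] without computing its iterated derivatives. *)
Inductive flat_sin_algebra {R : realType} : (R -> R) -> Prop :=
| fsa_flat m : flat_sin_algebra (fun x => flat m (- sin (2 * pi * x)))
| fsa_sin : flat_sin_algebra (fun x => sin (2 * pi * x))
| fsa_cos : flat_sin_algebra (fun x => cos (2 * pi * x))
| fsa_cst c : flat_sin_algebra (cst c)
| fsa_add f g : flat_sin_algebra f -> flat_sin_algebra g ->
    flat_sin_algebra (fun x => f x + g x)
| fsa_mul f g : flat_sin_algebra f -> flat_sin_algebra g ->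
    flat_sin_algebra (fun x => f x * g x).

Lemma flat_sin_algebra_smooth {R : realType} (f : R -> R) :
  flat_sin_algebra f -> smooth f.
Proof.
move: f; apply: smooth_of_closed => f.
have dl x : is_derive x (1 : R) (fun y : R => 2 * pi * y) (2 * pi).
  by apply: is_derive_eq; rewrite /GRing.scale/= mulr1.
have ds x : is_derive x (1 : R) (fun y : R => sin (2 * pi * y))
    (cos (2 * pi * x) * (2 * pi)).
  by apply: (@is_derive1_comp _ sin (fun y : R => 2 * pi * y)).
have dc x : is_derive x (1 : R) (fun y : R => cos (2 * pi * y))
    (- sin (2 * pi * x) * (2 * pi)).
  by apply: (@is_derive1_comp _ cos (fun y : R => 2 * pi * y)).
elim=> [m||| c|{}f g Pf [f' Pf' df] Pg [g' Pg' dg]|{}f g Pf [f' Pf' df] Pg [g' Pg' dg]].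
(* Orders m + 2 and m + 1 appear here, which is why the class has generators of every order. *)
- exists (fun x => (flat m.+2 (- sin (2 * pi * x)) +
    (- m%:R) * flat m.+1 (- sin (2 * pi * x))) *
    (cos (2 * pi * x) * (- (2 * pi)))).
    apply: fsa_mul; last by apply: fsa_mul; [exact: fsa_cos|exact: fsa_cst].
    apply: fsa_add; first exact: fsa_flat.
    by apply: fsa_mul; [exact: fsa_cst|exact: fsa_flat].
  move=> x; rewrite mulNr.
  apply: (@is_derive1_comp _ (flat m) (fun y : R => - sin (2 * pi * y))).
    exact: is_derive_flat.
  by apply: is_derive_eq; rewrite mulrN.
- exists (fun x => cos (2 * pi * x) * (2 * pi)) => //.
  by apply: fsa_mul; [exact: fsa_cos|exact: fsa_cst].
- exists (fun x => sin (2 * pi * x) * (- (2 * pi))).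
    by apply: fsa_mul; [exact: fsa_sin|exact: fsa_cst].
  by move=> x; rewrite mulrN -mulNr.
- by exists (cst 0); [exact: fsa_cst|move=> x; exact: is_derive_cst].
- exists (fun x => f' x + g' x); first exact: fsa_add.
  by move=> x; exact: is_deriveD.
- exists (fun x => f x * g' x + g x * f' x).
    by apply: fsa_add; exact: fsa_mul.
  by move=> x; exact: is_deriveM.
Qed.

(** Equal to exp(1 / sin(2 pi x)) where the sine is negative and 0 elsewhere; composing with the
    sine makes periodicity and smoothness across the integers automatic. *)
Definition bump {R : realType} (x : R) : R := flat 0 (- sin (2 * pi * x)).

Lemma bump_periodic {R : realType} : periodic (@bump R) 1.
Proof.
move=> x; rewrite /bump; congr (flat 0 (- _)).
by rewrite mulrDr mulr1 (mulrC 2 pi) mulr_natr sinD2pi.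
Qed.

Lemma bump_eq0 {R : realType} (x : R) : 0 <= x <= 1 / 2 -> bump x = 0.
Proof.
move=> /andP[x0 x1]; rewrite /bump /flat oppr_gt0 ltNge sin_ge0_pi//.
have := pi_gt0 R => p0.
by apply/andP; split; nra.
Qed.

Lemma bump_gt0 {R : realType} (x : R) : 1 / 2 < x < 1 -> 0 < bump x.
Proof.
move=> /andP[x0 x1]; apply: flat_gt0.
have := pi_gt0 R => p0.
rewrite oppr_gt0 -[X in sin X](subrK pi) sinDpi oppr_lt0.
by apply: sin_gt0_pi; apply/andP; split; nra.
Qed.

Lemma continuous_bump {R : realType} : continuous (@bump R).
Proof.
have sb : smooth (@bump R) by apply: flat_sin_algebra_smooth; exact: fsa_flat.
by move=> x; apply/differentiable_continuous/derivable1_diffP/(sb 0%N).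
Qed.

(** * Domination and linearity for integrals *)

Local Notation mu := lebesgue_measure.

Lemma integrable_le {d : measure_display} {T : measurableType d} {R : realType}
    {m : {measure set T -> \bar R}} {D : set T} {f g : T -> R} :
  m.-integrable D (EFin \o g) -> measurable D ->
  measurable_fun [set: T] f -> (forall x, `|f x| <= g x) ->
  m.-integrable D (EFin \o f).
Proof.
move=> gi mD mf fg; apply: le_integrable gi => //.
  by apply/measurable_EFinP; exact: measurable_funTS.
by move=> x _; rewrite lee_fin (le_trans (fg x)) ?ler_norm.
Qed.

Lemma integrable_lin {d : measure_display} {T : measurableType d} {R : realType}
    {m : {measure set T -> \bar R}} {D : set T} {f g : T -> R} (a b : R) :
  m.-integrable D (EFin \o f) -> m.-integrable D (EFin \o g) -> measurable D ->
  m.-integrable D (EFin \o (fun x => a * f x + b * g x)).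
Proof.
move=> fi gi mD.
have := integrableD mD (integrableZl mD a fi) (integrableZl mD b gi).
by [].
Qed.

Lemma Rintegral_lin {d : measure_display} {T : measurableType d} {R : realType}
    {m : {measure set T -> \bar R}} {D : set T} {f g : T -> R} (a b : R) :
  m.-integrable D (EFin \o f) -> m.-integrable D (EFin \o g) -> measurable D ->
  (\int[m]_(x in D) (a * f x + b * g x) =
   a * \int[m]_(x in D) f x + b * \int[m]_(x in D) g x)%R.
Proof.
move=> fi gi mD; rewrite RintegralD//; first by rewrite !RintegralZl.
- exact: (integrableZl mD a fi).
- exact: (integrableZl mD b gi).
Qed.

(** * Measurability and boundedness of the kernel *)

Lemma measurable_sinh {R : realType} : measurable_fun [set: R] (@sinh R).
Proof.
apply: measurable_funM => //; apply: measurable_funB.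
  exact: measurable_expR.
by apply: measurableT_comp => //; exact: measurable_expR.
Qed.

Lemma measurable_dxG {R : realType} : measurable_fun [set: R] (@dxG R).
Proof.
apply: measurable_funM => //; apply: (measurableT_comp measurable_sinh).
apply: measurable_funB => //; apply: measurable_funB => //.
apply: nondecreasing_measurable => // x y xy.
by rewrite ler_int le_floor.
Qed.

(** The argument of [sinh] lies in [-1/2, 1/2), so both exponentials are at most e. *)
Lemma dxG_bounded {R : realType} : exists2 M : R, 0 <= M & forall x, `|dxG x| <= M.
Proof.
exists (expR 1 * `|(2 * sinh (1 / 2 : R))^-1|); first by rewrite mulr_ge0 ?expR_ge0.
move=> x; rewrite /dxG normrM ler_wpM2r//.
have /andP[x0 x1] : 0 <= x - (Num.floor x)%:~R < 1.
  by rewrite subr_ge0 ltrBlDl floor_le/= (lt_le_trans (floorD1_gt x))// intrD.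
set y := x - _ in x0 x1 *.
rewrite /sinh normrM (ger0_norm (_ : 0 <= 2^-1))// ler_pdivrMr//.
apply: (le_trans (ler_normB _ _)); rewrite !ger0_norm ?expR_ge0//.
rewrite (_ : expR 1 * 2 = expR 1 + expR 1); last by ring.
by apply: lerD; rewrite ler_expR; lra.
Qed.

(** * Continuity of the nonlocal term with respect to the L^2 distance *)

Definition L2_on {R : realType} (f : R -> R) : Prop :=
  measurable_fun [set: R] f /\
  mu.-integrable `[0, 1] (EFin \o (fun x => f x ^+ 2)).

(** The Fourier sum has nonnegative terms. Thus H^s convergence in time forces L^2 convergence. *)
Lemma L2_sqnorm_le {R : realType} (s : R) (f : R -> R) :
  (L2_sqnorm f <= sobolev_sqnorm s f)%E.
Proof.
rewrite leeDl//; apply: esum_ge0 => k _.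
by rewrite lee_fin mulr_ge0 ?powR_ge0// addr_ge0 ?sqr_ge0.
Qed.

Lemma sobolev_L2 {R : realType} {s : R} {f : R -> R} : sobolev s f -> L2_on f.
Proof.
move=> [_ mf sf]; split => //; apply/integrableP; split.
  apply/measurable_EFinP; apply: measurable_funX.
  exact: measurable_funTS.
under eq_integral do rewrite /= ger0_norm ?sqr_ge0//.
exact: le_lt_trans (L2_sqnorm_le s f) sf.
Qed.

Lemma L2_sqnormE {R : realType} {f : R -> R} : L2_on f ->
  L2_sqnorm f = (\int[mu]_(x in `[0, 1]) (f x ^+ 2))%R%:E.
Proof. by move=> [_ fi]; rewrite fineK//; exact: integrable_fin_num. Qed.

Lemma integrable01_cst {R : realType} (c : R) :
  mu.-integrable `[0, 1] (EFin \o (fun _ : R => c)).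
Proof.
apply: continuous_compact_integrable; first exact: segment_compact.
by move=> x; exact: cvg_cst.
Qed.

Lemma Rintegral01_cst {R : realType} (c : R) :
  \int[mu]_(_ in `[0, 1]) c = c.
Proof.
by rewrite Rintegral_cst//= lebesgue_measure_itv/= lte_fin ltr01/= oppr0 addr0 mulr1.
Qed.

(** The square of the difference is dominated by 2 f^2 + 2 g^2, the gap being (f + g)^2. *)
Lemma L2_onB {R : realType} {f g : R -> R} : L2_on f -> L2_on g -> L2_on (f \- g).
Proof.
move=> [mf fi] [mg gi]; have mfg := measurable_funB mf mg; split => //.
apply: integrable_le (integrable_lin 2 2 fi gi _) _ _ _ => //.
  exact: measurable_funX.
move=> x; rewrite ger0_norm ?sqr_ge0//=.
by have := sqr_ge0 (f x + g x); nra.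
Qed.

(** Since |v + v^2/2| <= 1 + v^2, the integrand is dominated by M (1 + f^2), with M a bound for the
    kernel. *)
Lemma bbm_nonlocal_integrable {R : realType} (x : R) {f : R -> R} : L2_on f ->
  mu.-integrable `[0, 1] (EFin \o (fun y => dxG (x - y) * (f y + f y ^+ 2 / 2))).
Proof.
move=> [mf fi]; have [M M0 HM] := @dxG_bounded R.
apply: integrable_le (integrable_lin M M (integrable01_cst 1) fi _) _ _ _ => //.
  apply: measurable_funM.
    by apply: (measurableT_comp measurable_dxG); exact: measurable_funB.
  by apply: measurable_funD => //; apply: measurable_funM => //; exact: measurable_funX.
move=> y; rewrite normrM -mulrDr ler_pM//.
have := sqr_ge0 (f y + 1); have := sqr_ge0 (f y - 1).
by rewrite ler_norml => *; apply/andP; split; nra.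
Qed.

(* AM-GM in the form |D| <= (e + D^2/e) / 2 and |g D| <= (e g^2 + D^2/e) / 2,
   with D = f - g, replaces the Cauchy-Schwarz inequality. *)
Lemma bbm_nonlocal_dist {R : realType} : exists2 M : R, 0 < M &
  forall (x e : R) (f g : R -> R), 0 < e -> L2_on f -> L2_on g ->
  `|bbm_nonlocal f x - bbm_nonlocal g x| <=
    M * (e / 2 * (1 + \int[mu]_(y in `[0, 1]) (g y ^+ 2)) +
         (2^-1 + e^-1) * \int[mu]_(y in `[0, 1]) ((f y - g y) ^+ 2)).
Proof.
(* The bound M is only known to be nonnegative; M + 1 is a constant by which one can divide. *)
have [M M0 HM] := @dxG_bounded R; exists (M + 1); first by rewrite ltr_wpDl.
move=> x e f g e0 Lf Lg.
have [mfg fgi] := L2_onB Lf Lg; have [mg gi] := Lg.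
have If := bbm_nonlocal_integrable x Lf; have Ig := bbm_nonlocal_integrable x Lg.
rewrite /bbm_nonlocal /circle_conv -RintegralB//.
have /(_ (measurable_itv _)) Ifg := fun mI => integrableB mI If Ig.
apply: (le_trans (le_normr_Rintegral _ _)) => //.
have Ib := integrable_lin 1 1 (integrable01_cst (1 : R)) gi (measurable_itv _).
have Ir := integrable_lin ((M + 1) * (e / 2)) ((M + 1) * (2^-1 + e^-1))
  Ib fgi (measurable_itv _).
have -> : (M + 1) * (e / 2 * (1 + \int[mu]_(y in `[0, 1]) (g y ^+ 2)) +
    (2^-1 + e^-1) * \int[mu]_(y in `[0, 1]) ((f y - g y) ^+ 2)) =
  \int[mu]_(y in `[0, 1]) (((M + 1) * (e / 2)) * (1 * 1 + 1 * g y ^+ 2) +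
    ((M + 1) * (2^-1 + e^-1)) * (f y - g y) ^+ 2).
  have E1 : \int[mu]_(y in `[0, 1]) (1 * 1 + 1 * g y ^+ 2) =
      1 * \int[mu]_(y in `[0, 1]) 1 + 1 * \int[mu]_(y in `[0, 1]) (g y ^+ 2).
    exact: Rintegral_lin (integrable01_cst _) gi (measurable_itv _).
  rewrite [RHS](Rintegral_lin _ _ Ib fgi (measurable_itv _)).
  rewrite [X in _ = _ * X + _]E1 Rintegral01_cst.
  by rewrite [X in _ = _ + _ * X](_ : _ =
    \int[mu]_(y in `[0, 1]) ((f y - g y) ^+ 2))//; ring.
apply: le_Rintegral => //.
  exact: (integrable_norm Ifg).
move=> y _; rewrite -mulrBr normrM -2!(mulrA (M + 1)) -mulrDr.
apply: ler_pM => //; first by rewrite (le_trans (HM _))// lerDl.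
have De (a : R) : `|a * (f y - g y)| <= e / 2 * a ^+ 2 + e^-1 / 2 * (f y - g y) ^+ 2.
  have -> : e / 2 * a ^+ 2 + e^-1 / 2 * (f y - g y) ^+ 2 =
    e^-1 / 2 * ((e * a) ^+ 2 + (f y - g y) ^+ 2).
    by field; rewrite gt_eqF.
  have -> : a * (f y - g y) = e^-1 / 2 * (2 * (e * a) * (f y - g y)).
    by field; rewrite gt_eqF.
  have e2 : 0 <= e^-1 / 2 by rewrite divr_ge0// invr_ge0 ltW.
  rewrite normrM (ger0_norm e2) ler_wpM2l// ler_norml.
  apply/andP; split.
    by have := sqr_ge0 (e * a + (f y - g y)); nra.
  by have := sqr_ge0 (e * a - (f y - g y)); nra.
have := De 1; have := De (g y); rewrite mul1r => D1 D2.
(* Expanding around g gives D + g D + D^2/2 with D = f - g: the first two terms fall under [De] with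
   a = 1 and a = g, the last is kept as it is. *)
have -> : f y + f y ^+ 2 / 2 - (g y + g y ^+ 2 / 2) =
  (f y - g y) + g y * (f y - g y) + (f y - g y) ^+ 2 / 2 by field.
apply: (le_trans (ler_normD _ _)); apply: le_trans.
  by apply: lerD; [exact: ler_normD|exact: lexx].
have D3 : `|(f y - g y) ^+ 2 / 2| = (f y - g y) ^+ 2 / 2.
  by rewrite ger0_norm// divr_ge0// sqr_ge0.
rewrite D3.
by move: D1 D2; lra.
Qed.

Lemma bbm_nonlocal_continuous {R : realType} {s T : R} {u : R -> R -> R} (x : R) :
  C_sobolev s T u ->
  {within `[- T, T], continuous (fun r => bbm_nonlocal (u r) x)}.
Proof.
move=> uC; apply/subspace_continuousP => t tT.
have [ut ucv] := uC t tT.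
have Lt := sobolev_L2 ut.
have [M M0 HM] := @bbm_nonlocal_dist R.
apply/cvgrPdist_le => e e0 /=.
set G := \int[mu]_(y in `[0, 1]) (u t y ^+ 2).
have G0 : 0 <= G by apply: Rintegral_ge0 => y _; rewrite sqr_ge0.
(* The parameter h makes the term with 1 + G equal to e/2; G belongs to the fixed time t, so h does
   not depend on r. Then d, a bound on the squared L^2 distance, makes the other term e/2. *)
pose h := e / (M * (1 + G)).
have h0 : 0 < h by rewrite divr_gt0// mulr_gt0// ltr_wpDr.
pose d := e / (2 * M * (2^-1 + h^-1)).
have d0 : 0 < d by rewrite divr_gt0// !mulr_gt0// addr_gt0// invr_gt0.
have ndl : \forall r \near within `[- T, T]%classic (nbhs t),
    (sobolev_sqnorm s (u r \- u t)%R < d%:E)%E.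
  apply: (ucv [set z : \bar R | (z < d%:E)%E]); apply: open_nbhs_nbhs.
  by split; [exact: open_ereal_lt_ereal|rewrite /= lte_fin].
near=> r.
have rT : r \in `[- T, T] by near: r; exact: withinT.
have Lr := sobolev_L2 (uC r rT).1.
rewrite distrC; apply: (le_trans (HM x h _ _ h0 Lr Lt)).
rewrite -/G.
have Dd : \int[mu]_(y in `[0, 1]) ((u r y - u t y) ^+ 2) <= d.
  rewrite -lee_fin -(L2_sqnormE (L2_onB Lr Lt)) ltW//.
  apply: le_lt_trans (L2_sqnorm_le s _) _.
  by near: r.
have -> : e = M * (h / 2 * (1 + G) + (2^-1 + h^-1) * d).
  rewrite /d; set k := 2^-1 + h^-1.
  have k0 : k != 0 by rewrite gt_eqF// addr_gt0// invr_gt0.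
  rewrite /h; field.
  by rewrite k0 !gt_eqF// ltr_wpDr.
rewrite ler_pM2l// lerD2l ler_wpM2l// addr_ge0// invr_ge0 ltW//.
Unshelve. all: by end_near. Qed.

(** * Time derivative of a solution at t = 0 *)

(** For t of either sign the oriented integral is F t - F 0, with F the primitive based at -T. As 0
    is interior to [-T, T], the fundamental theorem of calculus applies there. *)
Lemma is_derive_oriented_integral0 {R : realType} {T : R} {g : R -> R} : 0 < T ->
  {within `[- T, T], continuous g} ->
  is_derive (0 : R) (1 : R) (fun t => oriented_integral0 t g) (g 0).
Proof.
move=> T0 gc.
have gi : mu.-integrable `[- T, T] (EFin \o g).
  by apply: continuous_compact_integrable => //; exact: segment_compact.
have NT : - T < 0 by rewrite oppr_lt0.
have c0 : {for 0, continuous g}.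
  apply: (within_continuous_continuous _ gc).
    by rewrite (lt_trans NT).
  by rewrite in_itv/= NT T0.
have [dF F'] := continuous_FTC1_closed T0 gi NT c0.
set F := (fun y : R => _) in dF F'.
have dF0 : is_derive (0 : R) (1 : R) (fun t => F t - F 0) (g 0).
  have dF1 : is_derive (0 : R) (1 : R) F (g 0).
    by apply: DeriveDef; [exact: dF|rewrite -derive1E; exact: F'].
  by apply: is_derive_eq; rewrite subr0.
apply: near_eq_is_derive dF0.
near=> t; rewrite /oriented_integral0.
have tT : t < T by near: t; exact: lt_nbhsl.
have Tt : - T < t by near: t; exact: lt_nbhsr.
have sub (a : R) : a <= T -> mu.-integrable `[- T, a] (EFin \o g).
  move=> aT; apply: integrableS gi => //.
  by apply: subset_itvl; rewrite bnd_simp.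
(* Differences of values of F are integrals over half-open intervals; the missing endpoint is a null
   set. *)
have oc (a b : R) : - T <= a -> b <= T ->
    \int[mu]_(x in `]a, b]) g x = \int[mu]_(x in `[a, b]) g x.
  move=> Ta bT; apply: Rintegral_itv_obnd_cbnd; apply: integrableS gi => //.
  by apply: subset_itv; rewrite bnd_simp.
case: ifPn => [t0|]; last rewrite -ltNge => t0.
  by rewrite /F Rintegral_itvB ?bnd_simp ?(ltW NT)// ?sub ?(ltW tT)//
    oc ?(ltW NT) ?(ltW tT).
rewrite -opprB; congr (- _).
by rewrite /F Rintegral_itvB ?bnd_simp ?(ltW t0) ?(ltW Tt)// ?sub ?(ltW T0)//
  oc ?(ltW Tt) ?(ltW T0).
Unshelve. all: by end_near. Qed.

(** At t = 0 the integral equation identifies [u 0] with [u0] pointwise; near 0 it expresses [u t x]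
    through the integral of a continuous function of time. *)
Lemma bbm_solution_derive0 {R : realType} {s T : R} {u0 : R -> R}
    {u : R -> R -> R} (x : R) : 0 < T -> bbm_solution s T u0 u ->
  is_derive (0 : R) (1 : R) (fun t => u t x) (- bbm_nonlocal u0 x).
Proof.
move=> T0 [uC uE].
have u00 : u 0 = u0.
  apply/funext => y; rewrite uE ?in_itv/= ?oppr_le0 ?ltW//.
  by rewrite /oriented_integral0 lexx set_itv1 Rintegral_set1 subr0.
have dI := is_derive_oriented_integral0 T0 (bbm_nonlocal_continuous x uC).
rewrite u00 in dI.
have dv : is_derive (0 : R) (1 : R)
    (fun t => u0 x - oriented_integral0 t (fun r => bbm_nonlocal (u r) x))
    (- bbm_nonlocal u0 x).
  by apply: is_derive_eq; rewrite add0r mul1r.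
apply: near_eq_is_derive dv.
near=> t; rewrite [RHS]uE// in_itv/=; apply/andP; split.
  by apply/ltW; near: t; apply: lt_nbhsr; rewrite oppr_lt0.
by apply/ltW; near: t; exact: lt_nbhsl.
Unshelve. all: by end_near. Qed.

(** * Strict positivity of integrals *)

(** If the integral were 0, f would vanish almost everywhere on D, and E would lie in a null set. *)
Lemma Rintegral_gt0 {d : measure_display} {T : measurableType d} {R : realType}
    {m : {measure set T -> \bar R}} (D E : set T) (f : T -> R) :
  measurable D -> measurable E -> E `<=` D -> (0 < m E)%E ->
  m.-integrable D (EFin \o f) ->
  (forall x, D x -> 0 <= f x) -> (forall x, E x -> 0 < f x) ->
  0 < (\int[m]_(x in D) f x)%R.
Proof.
move=> mD mE ED E0 fi f0 fE; rewrite lt_neqAle Rintegral_ge0// andbT.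
apply/negP => /eqP fD0; move: E0; rewrite lt_neqAle => /andP[/eqP + _]; apply.
have : (\int[m]_(x in D) `|(EFin \o f) x| = 0)%E.
  rewrite (eq_integral (EFin \o f)).
    by rewrite -(fineK (integrable_fin_num _ fi))//= -[fine _]/(Rintegral _ _ _) -fD0.
  by move=> x; rewrite inE => /f0 fx; rewrite /= ger0_norm.
move/(ae_eq_integral_abs m mD (measurable_int _ fi)) => [N [mN N0 sN]].
apply/esym/(subset_measure0 mE mN _ N0) => x Ex; apply: sN => /=.
move=> /(_ (ED _ Ex)) /= [fx0].
by have := fE _ Ex; rewrite fx0 ltxx.
Qed.

(** * Branches of the kernel, its zero mean, and its sign on the bump *)

Definition cosh {R : realType} (x : R) : R := (expR x + expR (- x)) / 2.

Lemma coshN {R : realType} (x : R) : cosh (- x) = cosh x.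
Proof. by rewrite /cosh opprK addrC. Qed.

Lemma sinh_lt {R : realType} : {homo @sinh R : x y / x < y}.
Proof.
move=> x y xy; rewrite /sinh ltr_pM2r// ltrB// ltr_expR//.
by rewrite ltrN2.
Qed.

Lemma sinh_gt0 {R : realType} (x : R) : 0 < x -> 0 < sinh x.
Proof. by move/sinh_lt; rewrite {1}/sinh oppr0 subrr mul0r. Qed.

Lemma continuous_sinh_sub {R : realType} (a : R) :
  continuous (fun y : R => sinh (a - y)).
Proof.
have dl x : is_derive x (1 : R) (fun y : R => sinh (a - y)) (- cosh (a - x)).
  by rewrite /sinh; apply: is_derive_eq; rewrite /GRing.scale/= /cosh; field.
move=> x; apply/differentiable_continuous/derivable1_diffP.
by have [] := dl x.
Qed.

Lemma is_derive_cosh_sub {R : realType} (a x : R) :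
  is_derive x (1 : R) (fun y : R => - cosh (a - y)) (sinh (a - x)).
Proof. by rewrite /cosh; apply: is_derive_eq; rewrite /GRing.scale/= /sinh; field. Qed.

Lemma Rintegral_sinh_sub {R : realType} (a p q : R) : p < q ->
  \int[mu]_(y in `[p, q]) (sinh (a - y)) = cosh (a - p) - cosh (a - q).
Proof.
move=> pq; rewrite /Rintegral.
have cc : continuous (fun y : R => - cosh (a - y)).
  move=> x; apply/differentiable_continuous/derivable1_diffP.
  by have [] := is_derive_cosh_sub a x.
rewrite (continuous_FTC2 (F := fun y => - cosh (a - y)))//=.
- by rewrite opprK addrC.
- by apply: continuous_subspaceT => x; exact: continuous_sinh_sub.
- split; first by move=> x _; have [] := is_derive_cosh_sub a x.
  + exact/cvg_at_right_filter/cc.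
  + exact/cvg_at_left_filter/cc.
- move=> x _; rewrite derive1E.
  by have [_ ->] := is_derive_cosh_sub a x.
Qed.

Lemma Rintegral_itv_oo_cc {R : realType} (f : R -> R) (p q : R) :
  mu.-integrable `[p, q] (EFin \o f) ->
  \int[mu]_(y in `]p, q[) f y = \int[mu]_(y in `[p, q]) f y.
Proof.
move=> fi; rewrite Rintegral_itv_bndo_bndc ?Rintegral_itv_obnd_cbnd//.
- by apply: integrableS fi => //; exact: subset_itv_oc_cc.
- by apply: integrableS fi => //; exact: subset_itv_oo_cc.
Qed.

(** Naming the floor yields the explicit branches: on 0 < y < 1 the floor of 0 - y is -1, while that
    of 1/2 - y is 0 up to y = 1/2 and -1 beyond. *)
Lemma dxGE {R : realType} (n : int) (z : R) : n%:~R <= z < n%:~R + 1 ->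
  dxG z = sinh (z - n%:~R - 1 / 2) / (2 * sinh (1 / 2)).
Proof. by move=> zn; rewrite /dxG (floor_def (m := n))// intrD. Qed.

Lemma dxG0E {R : realType} (y : R) : 0 < y < 1 ->
  dxG (0 - y) = sinh (1 / 2 - y) / (2 * sinh (1 / 2)).
Proof.
move=> /andP[y0 y1]; rewrite (dxGE (- 1)); last first.
  by apply/andP; split; lra.
by congr (sinh _ / _); lra.
Qed.

Lemma dxG_half_leE {R : realType} (y : R) : 0 < y <= 1 / 2 ->
  dxG (1 / 2 - y) = sinh (0 - y) / (2 * sinh (1 / 2)).
Proof.
move=> /andP[y0 y1]; rewrite (dxGE 0); last first.
  by apply/andP; split; lra.
by congr (sinh _ / _); lra.
Qed.

Lemma dxG_half_gtE {R : realType} (y : R) : 1 / 2 < y < 1 ->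
  dxG (1 / 2 - y) = sinh (1 - y) / (2 * sinh (1 / 2)).
Proof.
move=> /andP[y0 y1]; rewrite (dxGE (- 1)); last first.
  by apply/andP; split; lra.
by congr (sinh _ / _); lra.
Qed.

Lemma dxG_conv_integrable {R : realType} (x : R) {f : R -> R} : continuous f ->
  mu.-integrable `[0, 1] (EFin \o (fun y => dxG (x - y) * f y)).
Proof.
move=> cf; have [M M0 HM] := @dxG_bounded R.
have fi : mu.-integrable `[0, 1] (EFin \o (fun y => `|f y|)).
  apply: continuous_compact_integrable; first exact: segment_compact.
  by apply: continuous_subspaceT => y; apply: cvg_norm; exact: cf.
apply: integrable_le (integrable_lin M 0 fi fi _) _ _ _ => //.
  apply: measurable_funM; last exact: continuous_measurable_fun.
  by apply: (measurableT_comp measurable_dxG); exact: measurable_funB.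
by move=> y; rewrite mul0r addr0 normrM ler_wpM2r.
Qed.

Lemma dxG_integrable {R : realType} (x p q : R) : 0 <= p -> q <= 1 ->
  mu.-integrable `[p, q] (EFin \o (fun y => dxG (x - y))).
Proof.
move=> p0 q1.
have G1 : mu.-integrable `[0, 1] (EFin \o (fun y => dxG (x - y))).
  have c1 : continuous (cst (1 : R) : R -> R) by move=> y; apply: cst_continuous.
  have := dxG_conv_integrable x c1.
  by congr (integrable _ _ (EFin \o _)); apply/funext => y; rewrite mulr1.
by apply: integrableS G1 => //; apply: subset_itv; rewrite bnd_simp.
Qed.

(** The branch formula is required on the open interval only, because the kernel jumps where x - y
    is an integer; the endpoints are null. *)
Lemma Rintegral_dxG_piece {R : realType} (x a p q : R) : 0 <= p -> p < q -> q <= 1 ->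
  (forall y, p < y < q -> dxG (x - y) = sinh (a - y) / (2 * sinh (1 / 2))) ->
  \int[mu]_(y in `[p, q]) (dxG (x - y)) =
    (cosh (a - p) - cosh (a - q)) / (2 * sinh (1 / 2)).
Proof.
move=> p0 pq q1 E; rewrite -Rintegral_itv_oo_cc; last exact: dxG_integrable.
have si : mu.-integrable `[p, q] (EFin \o (fun y : R => sinh (a - y))).
  apply: continuous_compact_integrable; first exact: segment_compact.
  by apply: continuous_subspaceT => y; exact: continuous_sinh_sub.
rewrite -(Rintegral_sinh_sub _ _ _ pq) -(Rintegral_itv_oo_cc _ _ _ si).
rewrite -RintegralZr; last 2 first.
  exact: measurable_itv.
  apply: (@integrableS _ _ _ mu `[p, q]%classic) => //; exact: subset_itv_oo_cc.
by apply: eq_Rintegral => y; rewrite inE/= in_itv/= => /E.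
Qed.

(** One branch covers (0, 1), and the even function [cosh] takes the same value at 1/2 and -1/2. *)
Lemma Rintegral_dxG0 {R : realType} :
  \int[mu]_(y in `[0 : R, 1]) (dxG (0 - y)) = 0.
Proof.
rewrite (Rintegral_dxG_piece _ (1 / 2)) ?ltr01//; last exact: dxG0E.
by rewrite -(coshN (_ - 1)) (_ : - (1 / 2 - 1) = 1 / 2 - 0 :> R) ?subrr ?mul0r//; lra.
Qed.

(** The jump at y = 1/2 splits the integral. Up to the common factor, the halves give cosh 0 -
    cosh(1/2) and cosh(1/2) - cosh 0. *)
Lemma Rintegral_dxG_half {R : realType} :
  \int[mu]_(y in `[0 : R, 1]) (dxG (1 / 2 - y)) = 0.
Proof.
have h0 : (0 : R) < 1 / 2 by lra.
have h1 : (1 / 2 : R) < 1 by lra.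
rewrite -[LHS](subrK (\int[mu]_(y in `[0, 1 / 2]) (dxG (1 / 2 - y)))).
rewrite Rintegral_itvB ?bnd_simp ?ltW//; last exact: dxG_integrable.
rewrite Rintegral_itv_obnd_cbnd; last first.
  have G01 := dxG_integrable (1 / 2) 0 1 (lexx (0 : R)) (lexx 1).
  by apply: integrableS G01 => //; apply: subset_itv; rewrite bnd_simp// ltW.
have le_half (y : R) : 0 < y < 1 / 2 ->
    dxG (1 / 2 - y) = sinh (0 - y) / (2 * sinh (1 / 2)).
  by move=> /andP[y0 y1]; rewrite dxG_half_leE// y0 ltW.
rewrite (Rintegral_dxG_piece _ 1 _ _ (ltW h0) h1 (lexx 1) dxG_half_gtE).
rewrite (Rintegral_dxG_piece _ 0 _ _ (lexx 0) h0 (ltW h1) le_half).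
rewrite -(coshN (0 - 1 / 2)) (_ : - (0 - 1 / 2) = 1 - 1 / 2 :> R); last lra.
by rewrite !subrr; ring.
Qed.

(* On (1/2, 1), sinh (1/2 - y) < sinh (1 - y): the difference of the two kernels
   has a sign where the bump lives. *)
Lemma dxG_conv_lt {R : realType} (f : R -> R) : continuous f ->
  (forall y, 0 <= y <= 1 / 2 -> f y = 0) -> (forall y, 1 / 2 < y < 1 -> 0 < f y) ->
  f 1 = 0 ->
  \int[mu]_(y in `[0, 1]) (dxG (0 - y) * f y) <
  \int[mu]_(y in `[0, 1]) (dxG (1 / 2 - y) * f y).
Proof.
move=> cf f0 f1 f10; rewrite -subr_gt0 -RintegralB//; try exact: dxG_conv_integrable.
have pos y : 1 / 2 < y < 1 -> 0 < dxG (1 / 2 - y) * f y - dxG (0 - y) * f y.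
  move=> /[dup] y01 /andP[y0 y1].
  rewrite -mulrBl mulr_gt0 ?f1// dxG_half_gtE// dxG0E; last by rewrite y1 andbT; lra.
  rewrite subr_gt0 ltr_pM2r ?invr_gt0 ?mulr_gt0 ?sinh_gt0 ?divr_gt0//.
  by apply: sinh_lt; lra.
apply: (@Rintegral_gt0 _ _ _ mu _ `]1 / 2, 1[%classic) => //.
- by apply: subset_itv; rewrite bnd_simp; lra.
- rewrite /= lebesgue_measure_itv/= lte_fin ifT; last lra.
  by rewrite -EFinD lte_fin; lra.
- have /(_ (measurable_itv _)) := fun mI => integrableB mI
    (dxG_conv_integrable (1 / 2) cf) (dxG_conv_integrable 0 cf).
  by apply.
- move=> y; rewrite /= in_itv/= => /andP[y0 y1].
  have [y2|y2] := leP y (1 / 2); first by rewrite f0 ?y0// !mulr0 subrr.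
  (* The endpoint y = 1 escapes [pos], so the value [f 1 = 0] handles it. *)
  have [->|yn1] := eqVneq y 1; first by rewrite f10 !mulr0 subrr.
  by rewrite ltW// pos// y2 lt_neqAle yn1.
Qed.

(** * Choice of the amplitude and conclusion *)

(** For v = c + t f one has v + v^2/2 = (c + c^2/2) + t (1 + c) f + (t^2/2) f^2, and the zero mean
    of the kernel removes the constant. *)
Lemma bbm_nonlocal_affine {R : realType} (x c t : R) (f : R -> R) : continuous f ->
  \int[mu]_(y in `[0, 1]) (dxG (x - y)) = 0 ->
  bbm_nonlocal (fun y => c + t * f y) x =
    t * (1 + c) * (\int[mu]_(y in `[0, 1]) (dxG (x - y) * f y)) +
    t ^+ 2 / 2 * (\int[mu]_(y in `[0, 1]) (dxG (x - y) * f y ^+ 2)).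
Proof.
move=> cf I0.
have cf2 : continuous (fun y => f y ^+ 2) by move=> y; apply: cvgM; exact: cf.
have Gi := dxG_integrable x 0 1 (lexx _) (lexx _).
have G1 := dxG_conv_integrable x cf; have G2 := dxG_conv_integrable x cf2.
have G12 := integrable_lin (t * (1 + c)) (t ^+ 2 / 2) G1 G2 (measurable_itv _).
rewrite /bbm_nonlocal /circle_conv.
transitivity (\int[mu]_(y in `[0, 1]) ((c + c ^+ 2 / 2) * dxG (x - y) +
   1 * (t * (1 + c) * (dxG (x - y) * f y) + t ^+ 2 / 2 * (dxG (x - y) * f y ^+ 2)))).
  by apply: eq_Rintegral => y _; field.
rewrite [LHS](Rintegral_lin _ _ Gi G12 (measurable_itv _)).
rewrite [X in _ * X + _]I0 mulr0 add0r mul1r.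
exact: Rintegral_lin G1 G2 (measurable_itv _).
Qed.

Lemma bump_amplitude {R : realType} (c : R) : c != -1 ->
  exists2 t : R, t != 0 & let u0 := fun x => c + t * bump x in
    bbm_nonlocal u0 0 = bbm_nonlocal u0 (1 / 2).
Proof.
move=> c1; have {}c1 : 1 + c != 0 by rewrite addrC addr_eq0.
(* After division by t the equation is linear: (1 + c) (a1 - a0) + (t/2) (b1 - b0) = 0. *)
have balance (a0 a1 b0 b1 : R) : b1 - b0 != 0 ->
    let t := - 2 * (1 + c) * (a1 - a0) / (b1 - b0) in
    t * (1 + c) * a0 + t ^+ 2 / 2 * b0 = t * (1 + c) * a1 + t ^+ 2 / 2 * b1.
  by move=> b01 t; rewrite /t; field.
pose A (x : R) := \int[mu]_(y in `[0, 1]) (dxG (x - y) * bump y).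
pose B (x : R) := \int[mu]_(y in `[0, 1]) (dxG (x - y) * bump y ^+ 2).
have bump1 : bump 1 = 0 :> R.
  by rewrite -[1]add0r bump_periodic bump_eq0//; apply/andP; split; lra.
(* The strict inequality serves twice: for [bump] it makes t nonzero, for its square it allows the
   division defining t. *)
have A01 : A (1 / 2) - A 0 != 0.
  rewrite gt_eqF// subr_gt0; apply: dxG_conv_lt => //.
  - exact: continuous_bump.
  - exact: bump_eq0.
  - exact: bump_gt0.
have B01 : B (1 / 2) - B 0 != 0.
  rewrite gt_eqF// subr_gt0; apply: dxG_conv_lt.
  - by move=> y; apply: cvgM; exact: continuous_bump.
  - by move=> y y0; rewrite bump_eq0// expr0n.
  - by move=> y y0; rewrite exprn_gt0// bump_gt0.
  - by rewrite bump1 expr0n.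
exists (- 2 * (1 + c) * (A (1 / 2) - A 0) / (B (1 / 2) - B 0)).
  by rewrite !mulf_neq0// ?invr_eq0// oppr_eq0.
rewrite /= (bbm_nonlocal_affine _ _ _ _ continuous_bump Rintegral_dxG0).
rewrite (bbm_nonlocal_affine _ _ _ _ continuous_bump Rintegral_dxG_half).
exact: balance.
Qed.

Theorem theorem1p10 (R : realType) (c0 : R) (hc0 : c0 != -1) :
  exists (a b : R) (u0 : R -> R),
    [/\ 0 <= a, a < b & b < 1] /\
    [/\ periodic u0 1, smooth u0 & exists x, u0 x != c0] /\
    (forall x, a < x < b -> u0 x = c0) /\
    (forall (s T : R) (u : R -> R -> R), 0 <= s -> 0 < T ->
       bbm_solution s T u0 u ->
       [/\ derivable (fun t => u t a) 0 1,
           derivable (fun t => u t b) 0 1 &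
           derive1 (fun t => u t a) 0 = derive1 (fun t => u t b) 0]).
Proof.
have [t t0 Nu0] := bump_amplitude c0 hc0.
exists 0, (1 / 2), (fun x => c0 + t * bump x); split; first by split; lra.
split; first split.
- by move=> x; rewrite bump_periodic.
- apply: flat_sin_algebra_smooth; apply: fsa_add; first exact: fsa_cst.
  by apply: fsa_mul; [exact: fsa_cst|exact: fsa_flat].
(* The midpoint of (1/2, 1), where the bump is positive and t times it is nonzero. *)
- exists (3 / 4); rewrite {Nu0} -subr_eq0 addrC addKr mulf_neq0// gt_eqF// bump_gt0//.
  by apply/andP; split; lra.
split.
  by move=> {Nu0} x /andP[x0 x1]; rewrite bump_eq0 ?mulr0 ?addr0// !ltW.
move=> s T u s0 T0 usol.
have d0 := bbm_solution_derive0 0 T0 usol.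
have d1 := bbm_solution_derive0 (1 / 2) T0 usol.
split; [by have [] := d0|by have [] := d1|].
rewrite !derive1E; have [_ d0E] := d0; have [_ d1E] := d1.
exact: etrans d0E (etrans (congr1 -%R Nu0) (esym d1E)).
Qed.
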